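(* Let $0<p\le1$ and $0<q\le\infty$. Let $U$ be a regular kernel on $\mathbb Z\times\mathbb Z$ and let $\{v_n\}_{n\in\mathbb Z},\{w_n\}_{n\in\mathbb Z}$ be sequences of nonnegative real numbers. Then the following three statements are equivalent. (i) There exists a constant $C$ such that $$\Big(\sum_{n\in\mathbb Z}\Big(\sum_{i=-\infty}^nU(i,n)a_i\Big)^qw_n\Big)^{1/q}\le C\Big(\sum_{n\in\mathbb Z}a_n^pv_n\Big)^{1/p}$$ for every sequence $\{a_n\}_{n\in\mathbb Z}$ of nonnegative real numbers. (ii) There exists a constant $C'$ such that $$\Big(\sum_{n\in\mathbb Z}\Big(\sup_{-\infty<i\le n}U(i,n)a_i\Big)^qw_n\Big)^{1/q}\le C'\Big(\sum_{n\in\mathbb Z}a_n^pv_n\Big)^{1/p}$$ for every sequence $\{a_n\}_{n\in\mathbb Z}$ of nonnegative real numbers. (iii) There exists a constant $C''$ such that $$\Big(\sum_{n\in\mathbb Z}\Big(\sum_{i=-\infty}^nU(i,n)^pa_i\Big)^{q/p}w_n\Big)^{p/q}\le C''\sum_{n\in\mathbb Z}a_nv_n$$ for every sequence $\{a_n\}_{n\in\mathbb Z}$ of nonnegative real numbers. Moreover, if $C,C',C''$ are the best constants in these three inequalities, then $C\approx C'\approx(C'')^{1/p}$.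
   Context: A function $U\colon\mathbb Z\times\mathbb Z\to[0,\infty)$ is a regular kernel if it is nonincreasing in the first variable, nondecreasing in the second variable, and there is a positive constant $c$ (the constant of regularity) with $U(i,n)\le c(U(i,j)+U(j,n))$ for all integers $i\le j\le n$. $A\approx B$ means $c_1A\le B\le c_2A$ with positive constants $c_1,c_2$ depending only on $p$, $q$ and the constant of regularity of $U$. Sums take values in $[0,\infty]$, with $0\cdot\infty=0$. When $q=\infty$, the left-hand sides are replaced by $\sup_nw_n\sum_{i\le n}U(i,n)a_i$, $\sup_nw_n\sup_{i\le n}U(i,n)a_i$ and $\sup_nw_n^p\sum_{i\le n}U(i,n)^pa_i$, respectively. *)

(* Defs.v *)
From HB Require Import structures.
From mathcomp Require Import all_boot all_order all_algebra.
From mathcomp Require Import all_classical all_reals all_analysis.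

Set Implicit Arguments.
Unset Strict Implicit.
Unset Printing Implicit Defensive.

Import Order.TTheory GRing.Theory Num.Theory.

Local Open Scope classical_set_scope.
Local Open Scope ring_scope.
Local Open Scope ereal_scope.

Record regular_kernel (R : realType) (c : R) (U : int -> int -> R) : Prop := {
  regular_const_gt0 : (0 < c)%R ;
  regular_ge0 : forall i n : int, (0 <= U i n)%R ;
  regular_nonincreasing_l :
    forall i j n : int, (i <= j)%R -> (U j n <= U i n)%R ;
  regular_nondecreasing_r :
    forall i j n : int, (j <= n)%R -> (U i j <= U i n)%R ;
  regular_triangle : forall i j n : int, (i <= j)%R -> (j <= n)%R ->
    (U i n <= c * (U i j + U j n))%R }.

(* The outer functionals act on nonnegative F : int -> \bar R and are meant
   for 0 < q; the value at q = -oo is junk. *)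
Definition outer_norm (R : realType) (q : \bar R) (w : int -> R)
    (F : int -> \bar R) : \bar R :=
  match q with
  | r%:E => (\esum_(n in [set: int]) (F n `^ r * (w n)%:E)) `^ r^-1
  | +oo => ereal_sup [set (w n)%:E * F n | n in [set: int]]
  | -oo => 0
  end.

(* The left-hand side of the third inequality: exponent q / p, with the
   convention that the weight becomes w ^ p when q = +oo. *)
Definition outer_norm_div (R : realType) (p : R) (q : \bar R) (w : int -> R)
    (F : int -> \bar R) : \bar R :=
  match q with
  | r%:E => (\esum_(n in [set: int]) (F n `^ (r / p) * (w n)%:E)) `^ (p / r)
  | +oo => ereal_sup [set ((w n) `^ p)%:E * F n | n in [set: int]]
  | -oo => 0
  end.

Definition sum_inequality (R : realType) (p : R) (q : \bar R)
    (U : int -> int -> R) (v w : int -> R) (C : R) : Prop :=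
  forall a : int -> R, (forall n, (0 <= a n)%R) ->
    outer_norm q w
      (fun n => \esum_(i in [set i : int | (i <= n)%R]) (U i n * a i)%:E)
    <= C%:E * (\esum_(n in [set: int]) (a n `^ p * v n)%:E) `^ p^-1.

Definition sup_inequality (R : realType) (p : R) (q : \bar R)
    (U : int -> int -> R) (v w : int -> R) (C : R) : Prop :=
  forall a : int -> R, (forall n, (0 <= a n)%R) ->
    outer_norm q w
      (fun n => ereal_sup [set (U i n * a i)%:E | i in [set i : int | (i <= n)%R]])
    <= C%:E * (\esum_(n in [set: int]) (a n `^ p * v n)%:E) `^ p^-1.

Definition power_inequality (R : realType) (p : R) (q : \bar R)
    (U : int -> int -> R) (v w : int -> R) (C : R) : Prop :=
  forall a : int -> R, (forall n, (0 <= a n)%R) ->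
    outer_norm_div p q w
      (fun n => \esum_(i in [set i : int | (i <= n)%R]) (U i n `^ p * a i)%:E)
    <= C%:E * \esum_(n in [set: int]) (a n * v n)%:E.

(* +oo when no constant is admissible.  The restriction 0 <= C only matters
   when both sides of the inequality vanish identically: every real C is then
   admissible, and the best constant is 0. *)
Definition best_constant (R : realType) (P : R -> Prop) : \bar R :=
  ereal_inf [set C%:E | C in [set C : R | (0 <= C)%R /\ P C]].

Definition comparable_up_to (R : realType) (c1 c2 : R) (A B : \bar R) : Prop :=
  c1%:E * A <= B /\ B <= c2%:E * A.

(* Main.v *)
Require Import Defs.
From HB Require Import structures.
From mathcomp Require Import all_boot all_order all_algebra.
From mathcomp Require Import all_classical all_reals all_analysis.
From mathcomp Require Import ring lra zify.

(** The three inequalities compare, for fixed weights, the norms of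
      sum_i U(i,n) a_i,   sup_i U(i,n) a_i,   (sum_i U(i,n)^p a_i^p)^(1/p),
    where the power inequality is read at the sequence a^p.  Since p <= 1, the
    p-th power of a sum is at most the sum of the p-th powers, so the three
    quantities satisfy sup <= sum <= power pointwise.  This gives
    C' <= C <= C''^(1/p), and everything rests on bounding C'' by a multiple
    of C'^p.

    The kernel V = U^p is again regular, with constant c^p
    ([regular_kernel_powR]), so it is enough to find for each sequence a a
    sequence b, of weighted sum at most K times that of a, with
      A_n = sum_(i <= n) V(i,n) a_i <= sup_(i <= n) V(i,n) b_i  for all n:
    the sup inequality applied to b^(1/p) then gives the power inequality for
    a.  The domination is pointwise in n, so it passes to every monotone outer
    functional, whatever q and w are.

    To build b, let n run upwards and close a block (e', e] each time that A_e
    exceeds lam times its value at the previous endpoint e'.  From an endpoint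
    up to the next one A grows at most by the factor lam, so only the values A_e need
    a bound.  The part of A_e coming from the block (e', e] is
    concentrated at one well chosen index of the block, without increasing the
    weighted sum ([weighted_pigeonhole], [greedy_peaks]).  The part coming from
    i <= e' is, by regularity, at most c A_e' + c V(e',e) S, where S is the sum
    of the a_i with i <= e'.  The first term is at most A_e / 2 when lam = 2c.
    For the second, the same greedy selection with the kernel 1 in place of V
    produces an index j <= e' carrying a mass comparable to S, and
    V(e',e) <= V(j,e) ([sup_dominates_sum]).

    This construction starts somewhere and handles finitely many n at a time,
    so it is applied on windows [-N, N] ([windowed_domination]); monotone
    convergence as N tends to infinity removes the truncation
    ([outer_norm_sup_le]). *)

Set Implicit Arguments.
Unset Strict Implicit.
Unset Printing Implicit Defensive.

Import Order.TTheory GRing.Theory Num.Theory.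

Local Open Scope classical_set_scope.
Local Open Scope ring_scope.

(** * Concentrating a sum at single indices *)

(** All the mass of x can be moved to one index i without lowering the sum of
    t x and without raising the sum of x v: otherwise t_k / v_k would lie
    strictly below the ratio of the two sums at every k, although that ratio
    is a weighted mean of the t_k / v_k.  The proof avoids these quotients, as
    t_k and v_k may vanish. *)
Lemma weighted_pigeonhole (R : realFieldType) (m n : nat) (t x v : nat -> R) :
  (m < n)%N -> (forall k, 0 <= t k) -> (forall k, 0 <= x k) ->
  (forall k, 0 <= v k) ->
  exists i beta, [/\ (m <= i < n)%N, 0 <= beta,
    \sum_(m <= k < n) t k * x k <= t i * beta &
    beta * v i <= \sum_(m <= k < n) x k * v k].
Proof.
move=> mn t0 x0 v0; set S := \sum_(m <= k < n) t k * x k.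
set W := \sum_(m <= k < n) x k * v k.
have W0 : 0 <= W by apply: sumr_ge0 => k _; apply: mulr_ge0.
have S0 : 0 <= S by apply: sumr_ge0 => k _; apply: mulr_ge0.
have [S_eq0|S_neq0] := eqVneq S 0.
  exists m, 0; split; rewrite ?leqnn ?mn //; first by rewrite S_eq0 mulr0.
  by rewrite mul0r.
have [/hasP[i]|/hasPn none] :=
    boolP (has (fun i => (0 < t i) && (S * v i <= t i * W)) (index_iota m n)).
  rewrite mem_index_iota => i_in /andP[ti le_i].
  exists i, (S / t i); split => //.
  - by rewrite divr_ge0 // ltW.
  - by rewrite mulrCA mulfV ?mulr1 ?gt_eqF.
  - by rewrite mulrAC ler_pdivrMr // [leRHS]mulrC.
(* If no index works, these nonnegative terms add up to zero, so they all
   vanish; this forces t x = 0. *)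
have term_ge0 k : (m <= k < n)%N -> 0 <= x k * (S * v k - t k * W).
  move=> k_in; apply: mulr_ge0 => //; rewrite subr_ge0.
  have := none k; rewrite mem_index_iota => /(_ k_in).
  rewrite negb_and -leNgt -ltNge => /orP[tk|/ltW //].
  by have -> : t k = 0; [apply/le_anti; rewrite tk t0|rewrite mul0r mulr_ge0].
have sum0 : \sum_(m <= k < n) x k * (S * v k - t k * W) = 0.
  rewrite (eq_bigr (fun k => S * (x k * v k) - t k * x k * W)); last first.
    by move=> k _; ring.
  by rewrite sumrB -mulr_sumr -mulr_suml mulrC subrr.
case/negP: S_neq0; apply/eqP; rewrite /S big_seq big1 // => k.
rewrite mem_index_iota => k_in.
have : x k * (S * v k - t k * W) = 0.
  apply/eqP; move/eqP: sum0; rewrite big_seq psumr_eq0; last first.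
    by move=> j; rewrite mem_index_iota; exact: term_ge0.
  by move=> /allP/(_ k); rewrite mem_index_iota k_in => /(_ isT).
move=> /eqP; rewrite mulf_eq0 => /orP[/eqP->|]; first by rewrite mulr0.
rewrite subr_eq0 => /eqP eqk.
have := none k; rewrite mem_index_iota => /(_ k_in).
rewrite eqk lexx andbT -leNgt => tk.
by have -> : t k = 0; [apply/le_anti; rewrite tk t0|rewrite mul0r].
Qed.

(** The index e closes a block [s, e]: the sum at the end s - 1 of the earlier
    blocks is smaller by the factor lam, and the contribution of the block to
    the sum at e is matched by a single value of b.  For s = 0 there are no
    earlier blocks; the junk value 0.-1 is then harmless, since the sum over
    k < s is empty. *)
Definition peak (R : realFieldType) (lam : R) (T : nat -> nat -> R)
    (a b : nat -> R) (e : nat) : Prop :=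
  exists s i, [/\ (s <= i <= e)%N,
    lam * \sum_(0 <= k < s) T k s.-1 * a k <= \sum_(0 <= k < e.+1) T k e * a k &
    \sum_(s <= k < e.+1) T k e * a k <= T i e * b i].

Lemma peak_le (R : realFieldType) (lam : R) (T : nat -> nat -> R)
    (a b b' : nat -> R) (e : nat) :
  (forall k n, 0 <= T k n) -> (forall k, (k <= e)%N -> b k <= b' k) ->
  peak lam T a b e -> peak lam T a b' e.
Proof.
move=> T0 bb' [s [i [/andP[si ie] prev loc]]]; exists s, i; split => //.
  by rewrite si.
by apply: (le_trans loc); rewrite ler_wpM2l // bb'.
Qed.

(** Induction on N.  The point N.+1 either stays within the factor lam of the
    last block endpoint e, and nothing changes, or it closes the new block
    [e.+1, N.+1], whose mass is moved to one index.  As the blocks are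
    disjoint, the weighted sum of b stays below that of a. *)
Lemma greedy_peaks (R : realFieldType) (lam : R) (T : nat -> nat -> R)
    (a v : nat -> R) (N : nat) :
  1 <= lam -> (forall k n, 0 <= T k n) ->
  (forall k, 0 <= a k) -> (forall k, 0 <= v k) ->
  exists b : nat -> R, [/\ forall k, 0 <= b k, forall k, (N < k)%N -> b k = 0,
    \sum_(0 <= k < N.+1) b k * v k <= \sum_(0 <= k < N.+1) a k * v k &
    forall n, (n <= N)%N -> exists e, [/\ (e <= n)%N,
      \sum_(0 <= k < n.+1) T k n * a k <=
        lam * \sum_(0 <= k < e.+1) T k e * a k &
      peak lam T a b e]].
Proof.
move=> lam1 T0 a0 v0; set A := fun n => \sum_(0 <= k < n.+1) T k n * a k.
have A0 n : 0 <= A n by apply: sumr_ge0 => k _; apply: mulr_ge0.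
have A_self n : A n <= lam * A n by rewrite ler_peMl.
(* The induction keeps track of the last endpoint e; b vanishes beyond it,
   which leaves room for the next block. *)
suff [e [b [eN [b0 b_supp bv] [AN peak_e] cover]]] : exists e b,
    [/\ (e <= N)%N,
      [/\ forall k, 0 <= b k, forall k, (e < k)%N -> b k = 0 &
        \sum_(0 <= k < e.+1) b k * v k <= \sum_(0 <= k < e.+1) a k * v k],
      A N <= lam * A e /\ peak lam T a b e &
      forall n, (n <= N)%N -> exists e, [/\ (e <= n)%N,
        A n <= lam * A e & peak lam T a b e]].
  exists b; split => // [k Nk|]; first by rewrite b_supp // (leq_ltn_trans eN).
  rewrite (big_cat_nat (leq0n e.+1)) //= [leRHS](big_cat_nat (leq0n e.+1)) //=.
  rewrite lerD // [leLHS]big_nat big1 => [|k /andP[ek _]].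
    by apply: sumr_ge0 => k _; apply: mulr_ge0.
  by rewrite b_supp // mul0r.
elim: N => [|N [e [b [eN [b0 b_supp bv] [AN peak_e] cover]]]].
  exists 0%N, (fun k => if k == 0%N then a 0%N else 0).
  have peak0 : peak lam T a (fun k => if k == 0%N then a 0%N else 0) 0.
    by exists 0%N, 0%N; split; rewrite // ?big_nil ?mulr0 ?A0 // big_nat1.
  split=> //; first split=> [k|[|k]|] //.
  - by case: ifP.
  - by rewrite !big_nat1.
  - by move=> n; rewrite leqn0 => /eqP->; exists 0%N.
have [AS|AS] := leP (A N.+1) (lam * A e).
  exists e, b; split=> //; first exact: leqW.
  by move=> n; rewrite leq_eqVlt => /orP[/eqP->|/cover//];
     exists e; split => //; apply: leqW.
have [i [beta [/andP[ei iN] beta0 loc betav]]] :=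
  @weighted_pigeonhole R e.+1 N.+2 (T^~ N.+1) a v eN (T0^~ N.+1) a0 v0.
pose b' k := if (k <= e)%N then b k else if k == i then beta else 0.
have b'0 k : 0 <= b' k by rewrite /b'; case: ifP => // _; case: ifP.
have b'i : b' i = beta by rewrite /b' leqNgt ei eqxx.
have peak' : peak lam T a b' N.+1.
  exists e.+1, i; split; rewrite ?b'i //; last exact: ltW.
  by rewrite ei -ltnS.
exists N.+1, b'; split => //.
- split => // [k Nk|].
    rewrite /b' leqNgt (leq_ltn_trans eN (ltnW Nk)) /=.
    by case: eqP Nk => // ->; rewrite ltnNge -ltnS iN.
  have eSN : (e.+1 <= N.+2)%N by exact: leqW.
  rewrite (big_cat_nat (leq0n e.+1) eSN) /=.
  rewrite [leRHS](big_cat_nat (leq0n e.+1) eSN) /= lerD //.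
    apply: le_trans bv; rewrite big_nat [leRHS]big_nat ler_sum // => k /andP[_].
    by rewrite ltnS /b' => ->.
  apply: le_trans betav.
  rewrite (bigD1_seq i) ?iota_uniq ?mem_index_iota ?ei ?iN //= b'i.
  rewrite big1_seq ?addr0 // => k /andP[ki].
  rewrite mem_index_iota => /andP[ek _].
  by rewrite /b' leqNgt ek (negbTE ki) mul0r.
- move=> n; rewrite leq_eqVlt => /orP[/eqP->|]; first by exists N.+1.
  rewrite ltnS => /cover [e' [e'n An peak_e']]; exists e'; split => //.
  apply: peak_le peak_e' => // k _; rewrite /b'; case: ifP => // /negbT.
  by rewrite -ltnNge => ek; rewrite b_supp //; case: ifP.
Qed.

(** The selection is made twice: b1 with the kernel V takes care of the mass
    inside the last block, and b2 with the kernel 1 of the mass before it,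
    which V sees through its value at the end of the earlier blocks. *)
Lemma sup_dominates_sum (R : realFieldType) (c : R) (V : nat -> nat -> R)
    (a v : nat -> R) (N : nat) :
  1 <= c -> (forall k n, 0 <= V k n) ->
  (forall i j n, (i <= j)%N -> V j n <= V i n) ->
  (forall i j n, (j <= n)%N -> V i j <= V i n) ->
  (forall i j n, (i <= j)%N -> (j <= n)%N -> V i n <= c * (V i j + V j n)) ->
  (forall k, 0 <= a k) -> (forall k, 0 <= v k) ->
  exists b : nat -> R, [/\ forall k, 0 <= b k, forall k, (N < k)%N -> b k = 0,
    \sum_(0 <= k < N.+1) b k * v k <=
      40 * c ^+ 2 * \sum_(0 <= k < N.+1) a k * v k &
    forall n, (n <= N)%N -> exists2 i, (i <= n)%N &
      \sum_(0 <= k < n.+1) V k n * a k <= V i n * b i].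
Proof.
move=> c1 V0 V_l V_r V_tri a0 v0.
have lam1 : 1 <= 2 * c by lra.
have c0 : 0 <= c by lra.
have [b1 [b10 b1_supp b1v b1_peak]] :=
  @greedy_peaks R (2 * c) V a v N lam1 V0 a0 v0.
have [b2 [b20 b2_supp b2v b2_peak]] :=
  @greedy_peaks R 2 (fun _ _ => 1) a v N (ler1n _ 2) (fun _ _ => ler01) a0 v0.
(* For the kernel 1 and lam = 2, the earlier blocks carry at most half of the
   partial sum of a, so the last block carries the other half. *)
have b2_sums n : (n <= N)%N ->
    exists2 j, (j <= n)%N & \sum_(0 <= k < n.+1) a k <= 4 * b2 j.
  move=> /b2_peak [e [en + [s [j [/andP[sj je] + loc]]]]].
  under eq_bigr do rewrite mul1r.
  under [in leRHS]eq_bigr do rewrite mul1r.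
  move=> An; under eq_bigr do rewrite mul1r.
  under [leRHS]eq_bigr do rewrite mul1r.
  move=> prev; move: loc; under eq_bigr do rewrite mul1r.
  rewrite mul1r => loc; exists j; first exact: leq_trans en.
  have cut : \sum_(0 <= k < e.+1) a k =
      \sum_(0 <= k < s) a k + \sum_(s <= k < e.+1) a k.
    by rewrite (big_cat_nat (leq0n s)) //= (leq_trans sj) // ltnW.
  lra.
(* A_n <= 2 c A_e <= 2 c (2 + 8 c) max(V b1, V b2), and
   2 c (2 + 8 c) <= 20 c^2 because c >= 1. *)
set K := 20 * c ^+ 2.
have K0 : 0 <= K by rewrite mulr_ge0 // exprn_ge0.
exists (fun k => K * (b1 k + b2 k)); split => [k|k Nk||n nN].
- by rewrite mulr_ge0 // addr_ge0.
- by rewrite b1_supp // b2_supp // addr0 mulr0.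
- rewrite (_ : \sum_(_ <= _ < _) _ = K * (\sum_(0 <= k < N.+1) b1 k * v k +
      \sum_(0 <= k < N.+1) b2 k * v k)); last first.
    rewrite -big_split mulr_sumr; apply: eq_bigr => k _ /=.
    by rewrite -mulrA mulrDl.
  set W := \sum_(0 <= k < N.+1) a k * v k in b1v b2v *.
  rewrite (_ : 40 * c ^+ 2 * W = K * (W + W)); last by rewrite /K; lra.
  by rewrite ler_wpM2l // lerD.
have [e [en An [s [i [/andP[si ie] prev loc]]]]] := b1_peak n nN.
have eN := leq_trans en nN.
have [j jn Ae] : exists2 j, (j <= n)%N & \sum_(0 <= k < e.+1) V k e * a k <=
    2 * (V i n * b1 i) + 8 * c * (V j n * b2 j).
  have {}loc : \sum_(s <= k < e.+1) V k e * a k <= V i n * b1 i.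
    by apply: (le_trans loc); rewrite ler_wpM2r // V_r.
  have seS : (s <= e.+1)%N by rewrite (leq_trans si) // ltnW.
  rewrite (big_cat_nat (leq0n s) seS) /= in prev *.
  case: s => [|s] in si loc prev seS *.
    exists i; first exact: leq_trans en.
    rewrite big_nil add0r.
    have : 0 <= V i n * b1 i by rewrite mulr_ge0.
    have : 0 <= c * (V i n * b2 i) by rewrite !mulr_ge0.
    lra.
  have se : (s <= e)%N by rewrite (leq_trans (ltnW si)).
  have [j js b2j] := b2_sums s (leq_trans se eN).
  exists j; first by rewrite (leq_trans js) // (leq_trans se).
  have tri : \sum_(0 <= k < s.+1) V k e * a k <=
      c * (\sum_(0 <= k < s.+1) V k s * a k + V s e * \sum_(0 <= k < s.+1) a k).
    rewrite [V s e * _]mulr_sumr -big_split mulr_sumr /=.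
    rewrite big_nat [leRHS]big_nat ler_sum // => k /andP[_]; rewrite ltnS => ks.
    by rewrite -mulrDl mulrA ler_wpM2r // V_tri.
  (* V s e <= V j n, as j <= s and e <= n. *)
  have far : c * (V s e * \sum_(0 <= k < s.+1) a k) <= 4 * (c * (V j n * b2 j)).
    rewrite [leRHS]mulrCA ler_wpM2l //.
    apply: (@le_trans _ _ (V j n * (4 * b2 j))); last by rewrite mulrCA.
    apply: ler_pM => //; first by apply: sumr_ge0.
    by rewrite (le_trans (V_l _ _ _ js)) // V_r.
  rewrite mulrDr in tri; rewrite /= in prev; lra.
have [P0 Q0] : 0 <= V i n * b1 i /\ 0 <= V j n * b2 j by rewrite !mulr_ge0.
have c2 : c <= c ^+ 2 by rewrite expr2 ler_peMl.
(* Of the two bounds V i n * b1 i and V j n * b2 j, the larger one decides at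
   which index the supremum is tested. *)
have final m (X : R) : (m <= n)%N -> 0 <= X -> V i n * b1 i <= X ->
    V j n * b2 j <= X -> X <= V m n * (b1 m + b2 m) ->
    exists2 m, (m <= n)%N &
      \sum_(0 <= k < n.+1) V k n * a k <= V m n * (K * (b1 m + b2 m)).
  move=> mn X0 leP leQ leX; exists m => //; apply: (le_trans An).
  rewrite mulrCA; apply: (@le_trans _ _ (K * X)); last by rewrite ler_wpM2l.
  have : 2 * c * \sum_(0 <= k < e.+1) V k e * a k <= 2 * c * ((2 + 8 * c) * X).
    rewrite ler_wpM2l ?mulr_ge0 //; apply: (le_trans Ae).
    by rewrite [leRHS]mulrDl lerD // ler_wpM2l ?mulr_ge0.
  move=> /le_trans; apply; rewrite mulrA ler_wpM2r // /K expr2 in c2 *.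
  nra.
have [PQ|QP] := leP (V i n * b1 i) (V j n * b2 j).
  by apply: (final j (V j n * b2 j)) => //; rewrite ler_wpM2l // lerDr.
apply: (final i (V i n * b1 i)) => //; [exact: leq_trans en|exact: ltW|].
by rewrite ler_wpM2l // lerDl.
Qed.

Local Open Scope ereal_scope.

(** * Powers of extended nonnegative numbers *)

Lemma le_poweR (R : realType) (r : R) (x y : \bar R) :
  (0 <= r)%R -> 0 <= x -> x <= y -> x `^ r <= y `^ r.
Proof.
move=> r0 x0 xy.
by apply: gt0_ler_poweR; rewrite // in_itv /= ?leey ?andbT // (le_trans x0).
Qed.

Lemma poweRK (R : realType) (r : R) (x : \bar R) :
  (r != 0)%R -> 0 <= x -> (x `^ r) `^ r^-1 = x.
Proof. by move=> r0 x0; rewrite -poweRrM mulfV // poweRe1. Qed.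

Lemma poweRVK (R : realType) (r : R) (x : \bar R) :
  (r != 0)%R -> 0 <= x -> (x `^ r^-1) `^ r = x.
Proof. by move=> r0 x0; rewrite -poweRrM mulVf // poweRe1. Qed.

Lemma poweR_le_root (R : realType) (r : R) (x y : \bar R) :
  (0 < r)%R -> 0 <= x -> 0 <= y -> x <= y `^ r^-1 -> x `^ r <= y.
Proof.
move=> r0 x0 y0 /(le_poweR (ltW r0) x0).
by rewrite poweRVK // gt_eqF.
Qed.

Lemma root_le_poweR (R : realType) (r : R) (x y : \bar R) :
  (0 < r)%R -> 0 <= x -> 0 <= y -> x <= y `^ r -> x `^ r^-1 <= y.
Proof.
move=> r0 x0 y0 xy; apply: poweR_le_root => //; first by rewrite invr_gt0.
by rewrite invrK.
Qed.

(** Both inequalities come from monotonicity alone, since x |-> x^r and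
    x |-> x^(1/r) are inverse to each other on [0, +oo]. *)
Lemma ereal_sup_poweR (R : realType) (T : Type) (D : set T)
    (f : T -> \bar R) (r : R) :
  (0 < r)%R -> D !=set0 -> (forall t, 0 <= f t) ->
  (ereal_sup [set f t | t in D]) `^ r = ereal_sup [set f t `^ r | t in D].
Proof.
move=> r0 [t0 Dt0] f0.
have sup_ge0 (g : T -> \bar R) : (forall t, 0 <= g t) ->
    0 <= ereal_sup [set g t | t in D].
  by move=> g0; apply: le_ereal_sup_tmp; exists (g t0) => //; exists t0.
have pow0 t : 0 <= f t `^ r by exact: poweR_ge0.
apply/le_anti/andP; split.
  apply: poweR_le_root => //; [exact: sup_ge0|exact: sup_ge0|].
  apply: ge_ereal_sup => _ [t Dt <-].
  rewrite -[leLHS](@poweRK _ r) ?gt_eqF //.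
  apply: le_poweR; rewrite ?invr_ge0 ?(ltW r0) //.
  by apply: ereal_sup_ubound; exists t.
apply: ge_ereal_sup => _ [t Dt <-]; apply: le_poweR => //; first exact: ltW.
by apply: ereal_sup_ubound; exists t.
Qed.

(** With s = x + y, the fractions x/s and y/s lie in [0, 1], where z <= z^p;
    adding the two resulting bounds gives s^p on the left. *)
Lemma powRD_le (R : realType) (p x y : R) : (0 < p)%R -> (p <= 1)%R ->
  (0 <= x)%R -> (0 <= y)%R -> ((x + y) `^ p <= x `^ p + y `^ p)%R.
Proof.
move=> p0 p1 x0 y0.
have [xy0|xy0] := eqVneq (x + y)%R 0%R.
  by rewrite xy0 powR0 ?gt_eqF // addr_ge0 // powR_ge0.
have s0 : (0 < x + y)%R by rewrite lt_neqAle eq_sym xy0 addr_ge0.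
have part z : (0 <= z)%R -> (z <= x + y)%R ->
    (z / (x + y) * (x + y) `^ p <= z `^ p)%R.
  move=> z0 zs; have [->|zn0] := eqVneq z 0%R.
    by rewrite !mul0r powR_ge0.
  rewrite -[in leRHS](divfK xy0 z) powRM ?divr_ge0 ?addr_ge0 //.
  rewrite ler_wpM2r ?powR_ge0 // ger1_powR //.
  rewrite divr_gt0 //=; last by rewrite lt_neqAle eq_sym zn0.
  by rewrite ler_pdivrMr // mul1r.
have := lerD (part x x0 _) (part y y0 _).
rewrite -!mulrDl divff // mul1r; apply; by rewrite ?lerDl ?lerDr.
Qed.

Lemma poweRD_le (R : realType) (p : R) (x y : \bar R) : (0 < p)%R ->
  (p <= 1)%R -> 0 <= x -> 0 <= y -> (x + y) `^ p <= x `^ p + y `^ p.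
Proof.
move=> p0 p1; case: x y => [x||] [y||] //= x0 y0.
- by rewrite lee_fin powRD_le.
- by rewrite gt_eqF // addey // -?poweR_EFin ?gt_eqF // ltNye.
- by rewrite gt_eqF // addye.
- by rewrite gt_eqF // addye.
Qed.

Lemma poweR_esum_le (R : realType) (T : choiceType) (D : set T) (p : R)
    (f : T -> \bar R) : (0 < p)%R -> (p <= 1)%R -> (forall t, 0 <= f t) ->
  (\esum_(t in D) f t) `^ p <= \esum_(t in D) (f t `^ p).
Proof.
move=> p0 p1 f0; apply: poweR_le_root => //.
- exact: esum_ge0.
- by apply: esum_ge0 => t _; apply: poweR_ge0.
apply: ge_ereal_sup => _ [X [finX XD] <-].
rewrite -[leLHS](@poweRK _ p) ?gt_eqF //; last by apply: fsume_ge0.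
apply: le_poweR; [by rewrite invr_ge0 ltW|exact: poweR_ge0|].
apply: (@le_trans _ _ (\sum_(t \in X) f t `^ p)); last first.
  by apply: ereal_sup_ubound; exists X.
rewrite !fsbig_finite //=; elim: (finmap.enum_fset (fset_set X)) => [|t s IHs].
  by rewrite !big_nil poweR0r // gt_eqF.
rewrite !big_cons; apply: (le_trans (poweRD_le _ _ _ _)) => //.
  by apply: sume_ge0 => i _.
exact: leeD2l.
Qed.

(** Raising to the power p <= 1 keeps the regularity inequality, because the
    p-th power is subadditive. *)
Lemma regular_kernel_powR (R : realType) (p c : R) (U : int -> int -> R) :
  (0 < p)%R -> (p <= 1)%R -> regular_kernel c U ->
  regular_kernel (c `^ p)%R (fun i n => U i n `^ p)%R.
Proof.
move=> p0 p1 [c0 U0 Ul Ur Utri].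
have le_pow x y : (0 <= x -> x <= y -> x `^ p <= y `^ p)%R.
  by move=> x0 xy; rewrite ge0_ler_powR ?nnegrE ?(ltW p0) // (le_trans x0).
split.
- exact: powR_gt0.
- by move=> i n; apply: powR_ge0.
- by move=> i j n ij; rewrite le_pow // Ul.
- by move=> i j n jn; rewrite le_pow // Ur.
- move=> i j n ij jn.
  apply: (le_trans (le_pow _ _ (U0 i n) (Utri i j n ij jn))).
  rewrite powRM ?addr_ge0 ?(ltW c0) // ler_wpM2l ?powR_ge0 // powRD_le //.
Qed.

(** * The outer functionals: monotonicity, roots and monotone limits *)

Lemma outer_norm_ge0 (R : realType) (q : \bar R) (w : int -> R)
    (F : int -> \bar R) : (forall n, 0 <= w n)%R -> (forall n, 0 <= F n) ->
  0 <= outer_norm q w F.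
Proof.
move=> w0 F0; case: q => [r||] //=; first exact: poweR_ge0.
apply: le_ereal_sup_tmp; exists ((w 0%R)%:E * F 0%R); first by exists 0%R.
by rewrite mule_ge0 // lee_fin.
Qed.

Lemma le_outer_norm (R : realType) (q : \bar R) (w : int -> R)
    (F G : int -> \bar R) : 0 < q -> (forall n, 0 <= w n)%R ->
  (forall n, 0 <= F n) -> (forall n, F n <= G n) ->
  outer_norm q w F <= outer_norm q w G.
Proof.
move=> q0 w0 F0 FG; case: q q0 => [r||] //= r0.
  rewrite lte_fin in r0; apply: le_poweR; first by rewrite invr_ge0 ltW.
    by apply: esum_ge0 => n _; rewrite mule_ge0 ?poweR_ge0 ?lee_fin.
  apply: le_esum => n _; rewrite lee_wpmul2r ?lee_fin //.
  by apply: le_poweR => //; apply: ltW.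
apply: ge_ereal_sup => _ [n _ <-]; apply: le_ereal_sup_tmp.
by exists ((w n)%:E * G n); [exists n|rewrite lee_wpmul2l ?lee_fin].
Qed.

(** Relates the two outer functionals, so that only [outer_norm] needs to be
    studied. *)
Lemma outer_norm_div_root (R : realType) (p : R) (q : \bar R) (w : int -> R)
    (F : int -> \bar R) : (0 < p)%R -> 0 < q -> (forall n, 0 <= w n)%R ->
  (forall n, 0 <= F n) ->
  outer_norm_div p q w F = outer_norm q w (fun n => F n `^ p^-1) `^ p.
Proof.
move=> p0 q0 w0 F0; case: q q0 => [r||] //= q0.
  rewrite -[RHS]poweRrM [(r^-1 * p)%R]mulrC; congr (_ `^ _).
  apply: eq_esum => n _.
  by rewrite -poweRrM mulrC.
rewrite ereal_sup_poweR //; last 2 first.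
- by exists 0%R.
- by move=> n; rewrite mule_ge0 ?poweR_ge0 ?lee_fin.
congr ereal_sup; apply: eq_imagel => n _ /=.
by rewrite poweRM ?poweR_ge0 ?lee_fin // poweRVK // gt_eqF.
Qed.

(** Monotone convergence, in the form of an upper bound: it suffices to pass to
    the limit in finite partial sums. *)
Lemma esum_sup_le (R : realType) (T : choiceType) (f : T -> \bar R)
    (g : nat -> T -> \bar R) (M : \bar R) :
  (forall N t, 0 <= g N t) -> (forall t, nondecreasing_seq (g ^~ t)) ->
  (forall t, f t = ereal_sup (range (g ^~ t))) ->
  (forall N, \esum_(t in [set: T]) g N t <= M) ->
  \esum_(t in [set: T]) f t <= M.
Proof.
move=> g0 g_nd f_sup gM; apply: ge_ereal_sup => _ [X [finX _] <-].
rewrite fsbig_finite //=.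
have cv : \sum_(t <- finmap.enum_fset (fset_set X)) g N t @[N --> \oo] -->
    \sum_(t <- finmap.enum_fset (fset_set X)) f t.
  apply: cvg_nnesum => t _; first by apply: nearW => N.
  by rewrite f_sup; apply: ereal_nondecreasing_cvgn.
apply: cvge_le cv; apply: nearW => N; apply: le_trans (gM N).
by apply: ereal_sup_ubound; exists X => //; rewrite fsbig_finite.
Qed.

Lemma outer_norm_sup_le (R : realType) (q : \bar R) (w : int -> R)
    (F : int -> \bar R) (G : nat -> int -> \bar R) (M : \bar R) :
  0 < q -> (forall n, 0 <= w n)%R ->
  (forall N n, 0 <= G N n) -> (forall n, nondecreasing_seq (G ^~ n)) ->
  (forall n, F n = ereal_sup (range (G ^~ n))) ->
  (forall N, outer_norm q w (G N) <= M) -> outer_norm q w F <= M.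
Proof.
move=> q0 w0 G0 G_nd F_sup GM.
have M0 : 0 <= M by apply: le_trans (GM 0%N); apply: outer_norm_ge0.
have F0 n : 0 <= F n.
  by rewrite F_sup; apply: le_ereal_sup_tmp; exists (G 0%N n) => //; exists 0%N.
have term_sup (h : \bar R -> \bar R) n : (forall x, 0 <= x -> 0 <= h x) ->
   (h (F n) = ereal_sup (range (fun N => h (G N n)))) ->
   (w n)%:E * h (F n) = ereal_sup (range (fun N => (w n)%:E * h (G N n))).
  move=> h0 ->; rewrite -ereal_supZl //.
  - by rewrite image_comp.
  - by apply/set0P; exists (h (G 0%N n)), 0%N.
case: q q0 GM => [r||] //= q0 GM.
  rewrite lte_fin in q0.
  apply: root_le_poweR => //.
    by apply: esum_ge0 => n _; rewrite mule_ge0 ?poweR_ge0 ?lee_fin.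
  apply: (@esum_sup_le _ _ _ (fun N n => G N n `^ r * (w n)%:E)).
  - by move=> N n; rewrite mule_ge0 ?poweR_ge0 ?lee_fin.
  - move=> n N N' NN'; rewrite lee_wpmul2r ?lee_fin // le_poweR ?(ltW q0) //.
    exact: G_nd.
  - move=> n; rewrite muleC (term_sup (poweR^~ r)).
    + by congr ereal_sup; apply: eq_imagel => N _; rewrite muleC.
    + by move=> x _; apply: poweR_ge0.
    + by rewrite F_sup ereal_sup_poweR //; exists 0%N.
  - move=> N; rewrite -[leLHS](@poweRVK _ r) ?gt_eqF //; last first.
      by apply: esum_ge0 => n _; rewrite mule_ge0 ?poweR_ge0 ?lee_fin.
    by apply: le_poweR (GM N); [exact: ltW|exact: poweR_ge0].
apply: ge_ereal_sup => _ [n _ <-]; rewrite (term_sup id) //.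
apply: ge_ereal_sup => _ [N _ <-]; apply: le_trans (GM N).
by apply: ereal_sup_ubound; exists n.
Qed.

(** * Truncation to windows *)

Definition window (N : nat) (n : int) : set int :=
  [set i : int | (- N%:Z <= i)%R /\ (i <= n)%R].

(** The sums are truncated in n as well as in i, because the concentrated
    sequence is constructed for finitely many n only. *)
Definition windowed_sum (R : realType) (V : int -> int -> R) (a : int -> R)
    (N : nat) (n : int) : \bar R :=
  if (`|n| <= N)%N then \esum_(i in window N n) (V i n * a i)%:E else 0.

Lemma windowed_sum_nondecreasing (R : realType) (V : int -> int -> R)
    (a : int -> R) (n : int) :
  (forall i n, 0 <= V i n)%R -> (forall i, 0 <= a i)%R ->
  nondecreasing_seq (fun N => windowed_sum V a N n).
Proof.
move=> V0 a0 N N' NN'; rewrite /windowed_sum.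
have term0 i : 0 <= (V i n * a i)%:E by rewrite lee_fin mulr_ge0.
case: ifPn => nN; last first.
  by case: ifP => // _; apply: esum_ge0 => i _; apply: term0.
rewrite (leq_trans nN NN'); apply: ge_ereal_sup => _ [X [finX XW] <-].
apply: ereal_sup_ubound; exists X => //; split => // i /XW [Ni ni]; split => //.
by apply: le_trans Ni; rewrite lerN2 lez_nat.
Qed.

Lemma finite_set_window (n : int) (X : set int) :
  finite_set X -> X `<=` [set i | (i <= n)%R] ->
  exists2 N, (`|n| <= N)%N & X `<=` window N n.
Proof.
move=> finX Xn.
exists (`|n| + \sum_(i <- finmap.enum_fset (fset_set X)) `|i|)%N.
  exact: leq_addr.
move=> i Xi; split; last exact: Xn.
have iX : i \in finmap.enum_fset (fset_set X).
  by have := in_fset_set finX i; rewrite mem_set.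
rewrite (big_rem i) //=; move: (\sum_(_ <- _) _)%N => s; lia.
Qed.

Lemma windowed_sum_sup (R : realType) (V : int -> int -> R)
    (a : int -> R) (n : int) :
  (forall i n, 0 <= V i n)%R -> (forall i, 0 <= a i)%R ->
  \esum_(i in [set i | (i <= n)%R]) (V i n * a i)%:E =
  ereal_sup (range (fun N => windowed_sum V a N n)).
Proof.
move=> V0 a0; have term0 i : 0 <= (V i n * a i)%:E by rewrite lee_fin mulr_ge0.
apply/le_anti/andP; split.
  apply: ge_ereal_sup => _ [X [finX Xn] <-].
  have [N nN XN] := finite_set_window finX Xn.
  apply: le_ereal_sup_tmp; exists (windowed_sum V a N n); first by exists N.
  by rewrite /windowed_sum nN; apply: ereal_sup_ubound; exists X.
apply: ge_ereal_sup => _ [N _ <-]; rewrite /windowed_sum; case: ifP => _.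
  apply: ge_ereal_sup => _ [X [finX XW] <-].
  by apply: ereal_sup_ubound; exists X => //; split => // i /XW [].
exact: esum_ge0.
Qed.

Lemma esum_window (R : realType) (N k : nat) (g : int -> R) :
  (forall i, 0 <= g i)%R ->
  \esum_(i in window N (k%:Z - N%:Z)%R) (g i)%:E =
  (\sum_(0 <= j < k.+1) g (j%:Z - N%:Z)%R)%:E.
Proof.
move=> g0; rewrite (reindex_esum `I_k.+1 _ (fun j : nat => (j%:Z - N%:Z)%R)).
  rewrite esum_fset //; last by move=> i _; rewrite lee_fin.
  by rewrite -fsbig_ord -sumEFin big_mkord.
split.
- by move=> j /= jk; split; lia.
- by move=> i j _ _ /= ij; lia.
- by move=> i [Ni ik]; exists (absz (i + N%:Z)%R) => /=; lia.
Qed.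

(** Translates [sup_dominates_sum] by N, from the indices 0, ..., 2N to the
    window [-N, N]. *)
Lemma windowed_domination (R : realType) (c : R) (V : int -> int -> R)
    (a v : int -> R) (N : nat) :
  regular_kernel c V -> (forall i, 0 <= a i)%R -> (forall i, 0 <= v i)%R ->
  exists b : int -> R, [/\ forall i, (0 <= b i)%R,
    \esum_(i in [set: int]) (b i * v i)%:E <=
      (40 * (Num.max 1 c) ^+ 2)%:E * \esum_(i in [set: int]) (a i * v i)%:E &
    forall n : int, (`|n| <= N)%N -> exists2 i, (i <= n)%R &
      windowed_sum V a N n <= (V i n * b i)%:E].
Proof.
move=> [c0 V0 Vl Vr Vtri] a0 v0.
pose sh (j : nat) : int := (j%:Z - N%:Z)%R.
have c1 : (1 <= Num.max 1 c)%R by rewrite le_max lexx.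
have tri i j n : (i <= j)%N -> (j <= n)%N ->
    (V (sh i) (sh n) <= Num.max 1 c * (V (sh i) (sh j) + V (sh j) (sh n)))%R.
  move=> ij jn; apply: le_trans (Vtri _ (sh j) _ _ _) _;
    try by rewrite /sh; lia.
  by rewrite ler_wpM2r ?addr_ge0 // le_max lexx orbT.
have [||b [b0 b_supp bv dom]] := @sup_dominates_sum R (Num.max 1 c)%R
    (fun i n => V (sh i) (sh n)) (a \o sh) (v \o sh) (N + N)%N c1
    (fun i n => V0 _ _) _ _ tri (fun i => a0 _) (fun i => v0 _).
- by move=> i j n ij; apply: Vl; rewrite /sh; lia.
- by move=> i j n jn; apply: Vr; rewrite /sh; lia.
pose bb (i : int) : R := if (- N%:Z <= i)%R then b (absz (i + N%:Z)%R) else 0%R.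
have bb_sh k : bb (sh k) = b k.
  rewrite /bb /sh ifT; last by lia.
  by congr b; lia.
exists bb; split.
- by move=> i; rewrite /bb; case: ifP.
- rewrite (_ : \esum_(i in [set: int]) _ =
      \esum_(i in window N (sh (N + N)%N)) (bb i * v i)%:E); last first.
    rewrite [RHS]esum_mkcond; apply: eq_esum => i _; case: ifPn => //.
    rewrite notin_setE /bb => iW; case: ifP => Ni; last by rewrite mul0r.
    rewrite b_supp ?mul0r // ltnNge; apply/negP => iN; apply: iW; split => //.
    by rewrite /sh; lia.
  rewrite esum_window; last first.
    by move=> i; rewrite mulr_ge0 // /bb; case: ifP.
  apply: (@le_trans _ _ ((40 * Num.max 1 c ^+ 2)%:E *
      \esum_(i in window N (sh (N + N)%N)) (a i * v i)%:E)).
    rewrite esum_window => [|i]; last exact: mulr_ge0.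
    rewrite -EFinM lee_fin; apply: le_trans bv.
    by rewrite (eq_bigr (fun k => b k * v (sh k))%R) // => k _; rewrite bb_sh.
  apply: lee_wpmul2l.
    by rewrite lee_fin mulr_ge0 // exprn_ge0 // (le_trans _ c1).
  apply: ge_ereal_sup => _ [X [finX _] <-].
  by apply: ereal_sup_ubound; exists X.
- move=> n nN; pose k := absz (n + N%:Z)%R.
  have nk : n = sh k by rewrite /sh /k; lia.
  have [i ik le_i] := dom k (ltac:(rewrite /k; lia) : (k <= N + N)%N).
  exists (sh i); first by rewrite nk /sh; lia.
  rewrite /windowed_sum nN nk bb_sh esum_window ?lee_fin // => j.
  exact: mulr_ge0.
Qed.

Lemma esum_mul_ge0 (R : realType) (T : choiceType) (x y : T -> R)
    (D : set T) :
  (forall i, 0 <= x i)%R -> (forall i, 0 <= y i)%R ->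
  0 <= \esum_(i in D) (x i * y i)%:E.
Proof. by move=> x0 y0; apply: esum_ge0 => i _; rewrite lee_fin mulr_ge0. Qed.

(** * The three inequalities *)

Lemma sup_inequality_of_sum (R : realType) (p : R) (q : \bar R)
    (U : int -> int -> R) (v w : int -> R) (C : R) :
  0 < q -> (forall i n, 0 <= U i n)%R -> (forall n, 0 <= w n)%R ->
  sum_inequality p q U v w C -> sup_inequality p q U v w C.
Proof.
move=> q0 U0 w0 sumC a a0; apply: le_trans (sumC a a0).
have term0 i n : 0 <= (U i n * a i)%:E by rewrite lee_fin mulr_ge0.
apply: le_outer_norm => // n.
  by apply: le_ereal_sup_tmp; exists (U n n * a n)%:E => //; exists n => /=.
apply: ge_ereal_sup => _ [i in_ <-].
apply: esum_ge; exists [set i]; last by rewrite fsbig_set1.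
by split => // j ->.
Qed.

(** The power inequality at the sequence a^p, together with
    (sum_i U a_i)^p <= sum_i U^p a_i^p. *)
Lemma sum_inequality_of_power (R : realType) (p : R) (q : \bar R)
    (U : int -> int -> R) (v w : int -> R) (C : R) :
  (0 < p)%R -> (p <= 1)%R -> 0 < q -> (0 <= C)%R ->
  (forall i n, 0 <= U i n)%R ->
  (forall n, 0 <= v n)%R -> (forall n, 0 <= w n)%R ->
  power_inequality p q U v w C -> sum_inequality p q U v w (C `^ p^-1)%R.
Proof.
move=> p0 p1 q0 C0 U0 v0 w0 powC a a0.
have := powC (fun n => a n `^ p)%R (fun n => powR_ge0 _ _).
set F := fun n => \esum_(i in _) _.
have F0 n : 0 <= F n by apply: esum_mul_ge0 => i; apply: powR_ge0.
rewrite outer_norm_div_root //; set S := \esum_(n in [set: int]) _ => le_CS.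
have S0 : 0 <= S by apply: esum_mul_ge0 => // i; apply: powR_ge0.
rewrite -poweR_EFin -poweRM ?lee_fin //.
have G0 : 0 <= outer_norm q w (fun n => F n `^ p^-1).
  by apply: outer_norm_ge0 => // n; apply: poweR_ge0.
apply: (@le_trans _ _ (outer_norm q w (fun n => F n `^ p^-1))).
  apply: le_outer_norm => // n; first exact: esum_mul_ge0.
  rewrite -[leLHS](@poweRK _ p) ?gt_eqF //; last exact: esum_mul_ge0.
  apply: le_poweR; [by rewrite invr_ge0 ltW|exact: poweR_ge0|].
  have term0 i : 0 <= (U i n * a i)%:E by rewrite lee_fin mulr_ge0.
  apply: (le_trans (poweR_esum_le _ p0 p1 term0)); apply: le_esum => i _.
  by rewrite poweR_EFin powRM.
rewrite -[leLHS](@poweRK _ p) ?gt_eqF //.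
by apply: le_poweR; [rewrite invr_ge0 ltW|exact: poweR_ge0|].
Qed.

(** On each window, the sup inequality is applied to b^(1/p), where b dominates
    a for the kernel U^p. *)
Lemma power_inequality_of_sup (R : realType) (p c : R) (q : \bar R)
    (U : int -> int -> R) (v w : int -> R) (C : R) :
  (0 < p)%R -> (p <= 1)%R -> 0 < q -> (0 <= C)%R ->
  regular_kernel c U ->
  (forall n, 0 <= v n)%R -> (forall n, 0 <= w n)%R ->
  sup_inequality p q U v w C ->
  power_inequality p q U v w (40 * (Num.max 1 (c `^ p)) ^+ 2 * C `^ p)%R.
Proof.
move=> p0 p1 q0 C0 regU v0 w0 supC a a0.
have U0 := regular_ge0 regU.
have regV := regular_kernel_powR p0 p1 regU.
set V := fun i n => (U i n `^ p)%R in regV.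
have V0 : forall i n, (0 <= V i n)%R by move=> i n; apply: powR_ge0.
set K := (40 * _)%R; set S := \esum_(n in _) _.
have K0 : (0 <= K)%R by rewrite mulr_ge0 // exprn_ge0 // le_max ler01.
have S0 : 0 <= S by exact: esum_mul_ge0.
have pV0 : (0 <= p^-1)%R by rewrite invr_ge0 ltW.
have W0 N n : 0 <= windowed_sum V a N n.
  by rewrite /windowed_sum; case: ifP => // _; apply: esum_mul_ge0.
rewrite outer_norm_div_root //; last first.
  by move=> n; apply: esum_mul_ge0 => // i; apply: powR_ge0.
apply: poweR_le_root => //.
- by apply: outer_norm_ge0 => // n; apply: poweR_ge0.
- by rewrite mule_ge0 // lee_fin mulr_ge0 // powR_ge0.
apply: (@outer_norm_sup_le _ _ _ _ (fun N n => windowed_sum V a N n `^ p^-1)).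
- by [].
- by [].
- by move=> N n; apply: poweR_ge0.
- move=> n N N' NN'; apply: le_poweR => //.
  exact: windowed_sum_nondecreasing.
- move=> n; rewrite -ereal_sup_poweR //.
  + by rewrite -(windowed_sum_sup n V0 a0).
  + by rewrite invr_gt0.
move=> N; have [b [b0 bv dom]] := windowed_domination N regV a0 v0.
have bp : (forall i, 0 <= b i `^ p^-1)%R by move=> i; apply: powR_ge0.
have le_sup := supC _ bp.
apply: (@le_trans _ _ (outer_norm q w (fun n => ereal_sup
   [set (U i n * b i `^ p^-1)%:E | i in [set i | (i <= n)%R]]))).
  apply: le_outer_norm => // n; first exact: poweR_ge0.
  have [nN|nN] := boolP (`|n| <= N)%N; last first.
    rewrite /windowed_sum (negbTE nN) poweR0r ?invr_eq0 ?gt_eqF //.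
    apply: le_ereal_sup_tmp; exists (U n n * b n `^ p^-1)%:E.
      by exists n => /=.
    by rewrite lee_fin mulr_ge0.
  have [i in_ le_i] := dom n nN; apply: le_ereal_sup_tmp.
  exists (U i n * b i `^ p^-1)%:E; first by exists i.
  apply: (le_trans (le_poweR pV0 (W0 N n) le_i)).
  by rewrite poweR_EFin powRM // /V -powRrM mulfV ?gt_eqF // powRr1.
apply: (le_trans le_sup).
rewrite (eq_esum (b := fun n => (b n * v n)%:E)); last first.
  by move=> n _; rewrite -powRrM mulVf ?gt_eqF // powRr1.
rewrite [(K * _)%:E]EFinM (muleC K%:E) -muleA.
rewrite poweRM ?lee_fin ?powR_ge0 //; last first.
  by rewrite mule_ge0 // lee_fin.
rewrite poweR_EFin -powRrM mulfV ?gt_eqF // powRr1 //.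
apply: lee_wpmul2l; first by rewrite lee_fin.
by apply: le_poweR => //; exact: esum_mul_ge0.
Qed.

Lemma sup_inequality_le (R : realType) (p : R) (q : \bar R)
    (U : int -> int -> R) (v w : int -> R) (C C' : R) :
  (C <= C')%R -> sup_inequality p q U v w C -> sup_inequality p q U v w C'.
Proof.
move=> CC' supC a a0; apply: (le_trans (supC a a0)).
by rewrite lee_wpmul2r ?lee_fin // poweR_ge0.
Qed.

Lemma power_inequality_le (R : realType) (p : R) (q : \bar R)
    (U : int -> int -> R) (v w : int -> R) (C C' : R) :
  (forall n, 0 <= v n)%R -> (C <= C')%R ->
  power_inequality p q U v w C -> power_inequality p q U v w C'.
Proof.
move=> v0 CC' powC a a0; apply: (le_trans (powC a a0)).
by rewrite lee_wpmul2r ?lee_fin // esum_mul_ge0.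
Qed.

(** * Best constants *)

Lemma best_constant_ge0 (R : realType) (P : R -> Prop) : 0 <= best_constant P.
Proof. by apply: le_ereal_inf_tmp => _ [C [C0 _] <-]; rewrite lee_fin. Qed.

Lemma best_constant_le (R : realType) (P : R -> Prop) (C : R) :
  (0 <= C)%R -> P C -> best_constant P <= C%:E.
Proof. by move=> C0 PC; apply: ereal_inf_lbound; exists C. Qed.

Theorem theorem2p3 (R : realType) (p : R) (q : \bar R) (c : R)
    (p_gt0 : (0 < p)%R) (p_le1 : (p <= 1)%R) (q_gt0 : 0 < q) :
  exists c1 c2 : R, [/\ (0 < c1)%R, (0 < c2)%R &
    forall (U : int -> int -> R) (v w : int -> R),
      regular_kernel c U ->
      (forall n, (0 <= v n)%R) ->
      (forall n, (0 <= w n)%R) ->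
      [/\ (exists C, sum_inequality p q U v w C) <->
            (exists C', sup_inequality p q U v w C'),
          (exists C', sup_inequality p q U v w C') <->
            (exists C'', power_inequality p q U v w C''),
          comparable_up_to c1 c2 (best_constant (sum_inequality p q U v w))
                                 (best_constant (sup_inequality p q U v w)) &
          comparable_up_to c1 c2 (best_constant (sup_inequality p q U v w))
                                 (best_constant (power_inequality p q U v w) `^ p^-1)]].
Proof.
pose K := (40 * (Num.max 1 (c `^ p)) ^+ 2)%R.
pose L := (K `^ p^-1)%R.
have K1 : (1 <= K)%R.
  have : (1 <= Num.max 1 (c `^ p) :> R)%R by rewrite le_max lexx.
  by move=> /(exprn_ege1 2); rewrite /K; lra.
have L1 : (1 <= L)%R by rewrite -(powRr0 K) ler_powR // invr_ge0 ltW.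
have L0 : (0 < L)%R by rewrite (lt_le_trans _ L1).
exists L^-1%R, L; rewrite invr_gt0; split => // U v w regU v0 w0.
have U0 := regular_ge0 regU.
have pV0 : (0 <= p^-1)%R by rewrite invr_ge0 ltW.
have sum_sup C : sum_inequality p q U v w C -> sup_inequality p q U v w C.
  exact: sup_inequality_of_sum.
have sup_pow C : (0 <= C)%R -> sup_inequality p q U v w C ->
    power_inequality p q U v w (K * C `^ p)%R.
  by move=> C0; apply: power_inequality_of_sup.
have pow_sum C : (0 <= C)%R -> power_inequality p q U v w C ->
    sum_inequality p q U v w (C `^ p^-1)%R.
  by move=> C0; apply: sum_inequality_of_power.
(* An admissible constant may be negative; enlarging it to its maximum with 0
   keeps it admissible and lets powers of it be taken. *)
have ex_sup_pow : (exists C, sup_inequality p q U v w C) ->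
    exists C, power_inequality p q U v w C.
  move=> [C supC]; exists (K * (Num.max 0 C) `^ p)%R; apply: sup_pow.
    by rewrite le_max lexx.
  by apply: sup_inequality_le supC; rewrite le_max lexx orbT.
have ex_pow_sum : (exists C, power_inequality p q U v w C) ->
    exists C, sum_inequality p q U v w C.
  move=> [C powC]; exists ((Num.max 0 C) `^ p^-1)%R; apply: pow_sum.
    by rewrite le_max lexx.
  by apply: power_inequality_le powC; rewrite // le_max lexx orbT.
set Bsum := best_constant (sum_inequality _ _ _ _ _).
set Bsup := best_constant (sup_inequality _ _ _ _ _).
set Bpow := best_constant (power_inequality _ _ _ _ _).
have Bsum0 : 0 <= Bsum by exact: best_constant_ge0.
have Bsup0 : 0 <= Bsup by exact: best_constant_ge0.
have Bpow0 : 0 <= Bpow by exact: best_constant_ge0.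
have sup_le_sum : Bsup <= Bsum.
  apply: le_ereal_inf_tmp => _ [C [C0 sumC] <-].
  by apply: best_constant_le => //; apply: sum_sup.
have sum_le_pow : Bsum <= Bpow `^ p^-1.
  rewrite -[leLHS](@poweRK _ p) ?gt_eqF //.
  apply: le_poweR => //; first exact: poweR_ge0.
  apply: le_ereal_inf_tmp => _ [C [C0 powC] <-].
  apply: poweR_le_root; rewrite ?lee_fin // poweR_EFin.
  by apply: best_constant_le; [exact: powR_ge0|exact: pow_sum].
have pow_le_sup : L^-1%:E * Bpow `^ p^-1 <= Bsup.
  apply: le_ereal_inf_tmp => _ [C [C0 supC] <-].
  have le_Bpow : Bpow <= (K * C `^ p)%:E.
    apply: best_constant_le; last exact: sup_pow.
    by rewrite mulr_ge0 ?powR_ge0 // (le_trans _ K1).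
  apply: (@le_trans _ _ (L^-1%:E * (L * C)%:E)); last first.
    by rewrite -EFinM mulrA mulVf ?mul1r // gt_eqF.
  apply: lee_wpmul2l; first by rewrite lee_fin invr_ge0 ltW.
  apply: (le_trans (le_poweR pV0 Bpow0 le_Bpow)).
  rewrite poweR_EFin powRM ?powR_ge0 ?(le_trans _ K1) //.
  by rewrite -powRrM mulfV ?gt_eqF // powRr1.
have le_L x : 0 <= x -> x <= L%:E * x.
  by move=> x0; rewrite lee_pemull // lee_fin.
have le_LV x : 0 <= x -> L^-1%:E * x <= x.
  by move=> x0; rewrite -[leRHS]mul1e lee_wpmul2r // lee_fin invf_le1.
have LV0 : 0 <= L^-1%:E by rewrite lee_fin invr_ge0 ltW.
split.
- split => [[C /sum_sup]|/ex_sup_pow/ex_pow_sum //]; by exists C.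
- by split => // /ex_pow_sum [C /sum_sup]; exists C.
- split; first exact: le_trans (lee_wpmul2l LV0 sum_le_pow) pow_le_sup.
  exact: le_trans sup_le_sum (le_L _ Bsum0).
- split.
    exact: le_trans (le_LV _ Bsup0) (le_trans sup_le_sum sum_le_pow).
  apply: (@le_trans _ _ (L%:E * (L^-1%:E * Bpow `^ p^-1))).
    by rewrite muleA -EFinM mulfV ?mul1e // gt_eqF.
  by apply: lee_wpmul2l => //; rewrite lee_fin ltW.
Qed.
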